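(* There is a constant $C>0$ such that for all positive integers $k$ and $d$ with $d\le 2^k$ there is a repeated game with incomplete information on one side $\Gamma=\langle X,p,I,J,G\rangle$ with $|X|=d$ states and $\|G\|>0$ such that $$v_k(p)-(\mathrm{cav}\,u)(p)\ge C\,\|G\|\,\frac{V(k,d)}{k}.$$
   Context: Martingale variation. For a finite set $X$, $\Delta(X)$ is the set of $p\in\mathbb{R}^X$ with $p(x)\ge 0$ and $\sum_{x}p(x)=1$, and $\|q\|_1=\sum_{x\in X}|q(x)|$. $\mathcal{M}_k(X,p)$ is the set of all martingales $p_0^k=p_0,\ldots,p_k$ (i.e. $E(p_t\mid p_0,\ldots,p_{t-1})=p_{t-1}$ for $1\le t\le k$) on some probability space with $p_t\in\Delta(X)$ for all $t$ and $p_0=p$ (constant). $V(p_0^k)=E\left(\sum_{t=1}^k\|p_t-p_{t-1}\|_1\right)$, $V(k,p)=\sup\{V(p_0^k):p_0^k\in\mathcal{M}_k(X,p)\}$, and $V(k,d)=\sup\{V(k,p):p\in\Delta(X),\ |X|=d\}$. Games. A (two-person zero-sum) repeated game with incomplete information on one side $\Gamma=\langle X,p,I,J,G\rangle$ consists of a state space $X$, a probability $p\in\Delta(X)$, finite nonempty sets of stage actions $I$ for player 1 (P1) and $J$ for player 2 (P2), and a list $G=(G^x)_{x\in X}$ of real $I\times J$ matrices, where $G^x_{i,j}$ is the payoff from P2 to P1 when in state $x$ the action pair $(i,j)$ is played. $\|G\|:=\max_{x,i,j}|G^x_{i,j}|$. The $k$-stage game $\Gamma_k(p)$: nature chooses $x\in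 X$ according to $p$ ($p$ is commonly known); P1 is informed of $x$, P2 is not. At each stage $1\le t\le k$, P1 chooses $i_t\in I$ and simultaneously P2 chooses $j_t\in J$; both choices are observed by both players after stage $t$. P1's choice of $i_t$ may depend on $x,i_1,j_1,\ldots,i_{t-1},j_{t-1}$, and P2's choice of $j_t$ may depend on $i_1,j_1,\ldots,i_{t-1},j_{t-1}$. Strategies $\sigma$ of P1 and $\tau$ of P2 (mixed or behavioral) together with $p$ define a probability distribution on plays $x,i_1,j_1,\ldots,i_k,j_k$, with expectation $E_{\sigma,\tau}$. The payoff is $\bar g_k=\frac1k\sum_{t=1}^kG^x_{i_t,j_t}$, and the value is $v_k(p):=\max_\sigma\min_\tau E_{\sigma,\tau}\bar g_k$. For fixed $X,I,J,G$ and $q\in\Delta(X)$, $u(q)$ is the minmax value (in mixed strategies) of the matrix game $\sum_{x}q(x)G^x$, and $\mathrm{cav}\,u$ is the least concave function on $\Delta(X)$ that is greater than or equal to $u$. *)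

(* Defs.v *)
From HB Require Import structures.
From mathcomp Require Import all_boot all_order all_algebra.
From mathcomp Require Import all_classical all_reals all_analysis.

Set Implicit Arguments.
Unset Strict Implicit.
Unset Printing Implicit Defensive.

Import Order.TTheory GRing.Theory Num.Theory.
Import numFieldNormedType.Exports.

Local Open Scope classical_set_scope.
Local Open Scope ring_scope.

Definition simplex (R : realType) (X : finType) : set {ffun X -> R} :=
  [set q | (forall x, 0 <= q x) /\ \sum_x q x = 1].
Arguments simplex : clear implicits.

Definition norm1 (R : realType) (X : finType) (q : {ffun X -> R}) : R :=
  \sum_x `|q x|.

(* [Z] is a version of the conditional expectation of [Y] given the
   sigma-algebra [F]. *)
Definition is_cond_expectation (R : realType) (disp : measure_display)
    (T : measurableType disp) (P : probability T R) (F : set (set T))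
    (Y Z : T -> R) : Prop :=
  [/\ forall B : set R, measurable B -> F (Z @^-1` B),
      P.-integrable setT (EFin \o Z) &
      forall A, F A ->
        (\int[P]_(w in A) (Z w)%:E = \int[P]_(w in A) (Y w)%:E)%E].

(* The sigma-algebra generated by the random vectors m 0, ..., m t. *)
Definition history (R : realType) (disp : measure_display)
    (T : measurableType disp) (X : finType) (m : nat -> T -> {ffun X -> R})
    (t : nat) : set (set T) :=
  <<s [set A | exists s x, (s <= t)%N /\
         preimage_set_system setT (fun w => m s w x) measurable A] >>.

(* Only the values m 0, ..., m k of the sequence [m] matter. *)
Definition martingale (R : realType) (disp : measure_display)
    (T : measurableType disp) (P : probability T R) (X : finType) (k : nat)
    (p : {ffun X -> R}) (m : nat -> T -> {ffun X -> R}) : Prop :=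
  [/\ forall t w, (t <= k)%N -> simplex R X (m t w),
      forall w, m 0%N w = p,
      forall t x, (t <= k)%N -> measurable_fun setT (fun w => m t w x) &
      forall t x, (t < k)%N ->
        is_cond_expectation P (history m t)
          (fun w => m t.+1 w x) (fun w => m t w x)].

Definition variation (R : realType) (disp : measure_display)
    (T : measurableType disp) (P : probability T R) (X : finType) (k : nat)
    (m : nat -> T -> {ffun X -> R}) : \bar R :=
  'E_P[fun w => (\sum_(0 <= t < k) norm1 (m t.+1 w - m t w))%R]%E.

Definition max_variation_from (R : realType) (X : finType) (k : nat)
    (p : {ffun X -> R}) : \bar R :=
  ereal_sup [set v | exists (disp : measure_display)
    (T : measurableType disp) (P : probability T R)
    (m : nat -> T -> {ffun X -> R}),
    martingale P k p m /\ v = variation P k m].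

(* Taken in the extended reals, so that no value has to be invented for
   suprema; it is finite, being at most 2 * k. *)
Definition max_variation (R : realType) (k d : nat) : \bar R :=
  ereal_sup [set v | exists (X : finType) (p : {ffun X -> R}),
    [/\ #|X| = d, simplex R X p & v = max_variation_from k p]].
Arguments max_variation : clear implicits.

Record game (R : realType) := Game {
  states : finType;
  prior : {ffun states -> R};
  actions1 : finType;
  actions2 : finType;
  payoff : states -> actions1 -> actions2 -> R;
  prior_simplex : simplex R states prior;
  actions1_gt0 : (0 < #|actions1|)%N;
  actions2_gt0 : (0 < #|actions2|)%N }.
Arguments payoff {R} g _ _ _.

Definition payoff_norm (R : realType) (X I J : finType)
    (G : X -> I -> J -> R) : R :=
  \big[Num.max/0]_x \big[Num.max/0]_i \big[Num.max/0]_j `|G x i j|.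

(* Behavioral strategies; a history is the sequence of past action pairs,
   oldest first. *)
Definition strategy1 (R : realType) (X I J : finType) :
    set (X -> seq (I * J) -> {ffun I -> R}) :=
  [set sigma | forall x h, simplex R I (sigma x h)].
Arguments strategy1 : clear implicits.

Definition strategy2 (R : realType) (I J : finType) :
    set (seq (I * J) -> {ffun J -> R}) :=
  [set tau | forall h, simplex R J (tau h)].
Arguments strategy2 : clear implicits.

Definition play_prob (R : realType) (X I J : finType) (k : nat)
    (p : {ffun X -> R}) (sigma : X -> seq (I * J) -> {ffun I -> R})
    (tau : seq (I * J) -> {ffun J -> R}) (x : X) (h : k.-tuple (I * J)) : R :=
  p x * \prod_(t < k) (sigma x (take t h) (tnth h t).1
                       * tau (take t h) (tnth h t).2).

Definition expected_payoff (R : realType) (X I J : finType)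
    (G : X -> I -> J -> R) (k : nat) (p : {ffun X -> R})
    (sigma : X -> seq (I * J) -> {ffun I -> R})
    (tau : seq (I * J) -> {ffun J -> R}) : R :=
  \sum_x \sum_(h : k.-tuple (I * J)) play_prob p sigma tau x h *
    (k%:R^-1 * \sum_(t < k) G x (tnth h t).1 (tnth h t).2).

(* The maximum and minimum are attained, hence equal to [sup] and [inf]; the
   sets involved are nonempty and bounded when I and J are nonempty and p is
   a probability (see [has_inf_repeated_value] and [has_sup_repeated_value]). *)
Definition repeated_value (R : realType) (X I J : finType)
    (G : X -> I -> J -> R) (k : nat) (p : {ffun X -> R}) : R :=
  sup [set inf [set expected_payoff G k p sigma tau | tau in strategy2 R I J]
      | sigma in strategy1 R X I J].

Definition mixed_payoff (R : realType) (X I J : finType)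
    (G : X -> I -> J -> R) (q : {ffun X -> R}) (a : {ffun I -> R})
    (b : {ffun J -> R}) : R :=
  \sum_i \sum_j a i * b j * (\sum_x q x * G x i j).

(* The minmax value, in mixed strategies, of the matrix game
   \sum_x q(x) G^x; see [has_sup_stage_value] and [has_inf_stage_value]. *)
Definition stage_value (R : realType) (X I J : finType) (G : X -> I -> J -> R)
    (q : {ffun X -> R}) : R :=
  inf [set sup [set mixed_payoff G q a b | a in simplex R I]
      | b in simplex R J].

Definition concave_on_simplex (R : realType) (X : finType)
    (f : {ffun X -> R} -> R) : Prop :=
  forall (q r : {ffun X -> R}) (l : R),
    simplex R X q -> simplex R X r -> 0 <= l <= 1 ->
    l * f q + (1 - l) * f r <= f [ffun x => l * q x + (1 - l) * r x].

Definition concave_majorant (R : realType) (X : finType)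
    (f g : {ffun X -> R} -> R) : Prop :=
  concave_on_simplex g /\ forall q, simplex R X q -> f q <= g q.

(* For f bounded above on the simplex this is the least element of
   [concave_majorant f], see [cav_concave_majorant] and [cav_le]; the stage
   value is bounded above by [stage_value_le]. *)
Definition cav (R : realType) (X : finType) (f : {ffun X -> R} -> R)
    (q : {ffun X -> R}) : R :=
  inf [set g q | g in concave_majorant f].

Lemma cav_le (R : realType) (X : finType) (f g : {ffun X -> R} -> R)
    (q : {ffun X -> R}) :
  simplex R X q -> concave_majorant f g -> cav f q <= g q.
Proof.
move=> sq fg; apply: ge_inf; last by exists g.
by exists (f q) => _ [h [_ fh] <-]; exact: fh.
Qed.

Lemma cav_concave_majorant (R : realType) (X : finType)
    (f : {ffun X -> R} -> R) (M : R) :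
  (forall q, simplex R X q -> f q <= M) -> concave_majorant f (cav f).
Proof.
move=> fM.
have ne q : [set g q | g in concave_majorant f] !=set0.
  exists M, (fun=> M) => //; split=> // a b l _ _ _.
  by rewrite -mulrDl addrC subrK mul1r.
split=> [q r l sq sr l01|q sq]; last first.
  by apply: lb_le_inf => // _ [g [_ fg] <-]; exact: fg.
apply: lb_le_inf => // _ [g [cg fg] <-].
apply: le_trans (cg q r l sq sr l01); case/andP: l01 => l0 l1.
by apply: lerD; apply: ler_wpM2l; rewrite ?subr_ge0 //; exact: cav_le.
Qed.

Lemma simplex_nonempty (R : realType) (X : finType) :
  (0 < #|X|)%N -> simplex R X !=set0.
Proof.
case/card_gt0P => x0 _; exists [ffun x => (x == x0)%:R]; split=> [x|].
  by rewrite ffunE ler0n.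
rewrite (bigD1 x0) //= ffunE eqxx big1 ?addr0 // => x /negPf nx.
by rewrite ffunE nx.
Qed.

Lemma simplex_le1 (R : realType) (X : finType) (q : {ffun X -> R}) (x : X) :
  simplex R X q -> q x <= 1.
Proof.
case=> q0 <-; rewrite (bigD1 x) //= lerDl.
by apply: sumr_ge0.
Qed.

Section bounded_values.
Context (R : realType) (S T : Type) (A : set S) (B : set T)
  (f : S -> T -> R) (M : R).
Hypotheses (A0 : A !=set0) (B0 : B !=set0).
Hypothesis fM : forall s t, A s -> B t -> `|f s t| <= M.

Lemma bounded_has_inf s : A s -> has_inf [set f s t | t in B].
Proof.
move=> As; case: B0 => t0 Bt0; split; first by exists (f s t0), t0.
by exists (- M) => _ [t Bt <-]; have /ler_normlP[] := fM As Bt; rewrite lerNl.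
Qed.

Lemma bounded_has_sup t : B t -> has_sup [set f s t | s in A].
Proof.
move=> Bt; case: A0 => s0 As0; split; first by exists (f s0 t), s0.
by exists M => _ [s As <-]; have /ler_normlP[] := fM As Bt.
Qed.

Lemma bounded_has_sup_inf :
  has_sup [set inf [set f s t | t in B] | s in A].
Proof.
case: A0 B0 => s0 As0 [t0 Bt0]; split; first by eexists; exists s0.
exists M => _ [s As <-]; apply: (@le_trans _ _ (f s t0)).
  by apply: ge_inf; [case: (bounded_has_inf As)|exists t0].
by have /ler_normlP[] := fM As Bt0.
Qed.

Lemma bounded_has_inf_sup :
  has_inf [set sup [set f s t | s in A] | t in B].
Proof.
case: A0 B0 => s0 As0 [t0 Bt0]; split; first by eexists; exists t0.
exists (- M) => _ [t Bt <-]; apply: (@le_trans _ _ (f s0 t)).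
  by have /ler_normlP[] := fM As0 Bt; rewrite lerNl.
by apply: ub_le_sup; [case: (bounded_has_sup Bt)|exists s0].
Qed.

Lemma bounded_inf_sup_le : inf [set sup [set f s t | s in A] | t in B] <= M.
Proof.
case: A0 B0 => s0 As0 [t0 Bt0]; apply: (@le_trans _ _ (sup [set f s t0 | s in A])).
  by apply: ge_inf; [case: bounded_has_inf_sup|exists t0].
apply: ge_sup; first by exists (f s0 t0), s0.
by move=> _ [s As <-]; have /ler_normlP[] := fM As Bt0.
Qed.

End bounded_values.

Section well_defined_values.
Context (R : realType) (X I J : finType) (G : X -> I -> J -> R).
Hypotheses (I0 : (0 < #|I|)%N) (J0 : (0 < #|J|)%N).

Lemma strategy1_nonempty : strategy1 R X I J !=set0.
Proof.
by have [a sa] := simplex_nonempty R I0; exists (fun _ _ => a) => x h.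
Qed.

Lemma strategy2_nonempty : strategy2 R I J !=set0.
Proof. by have [b sb] := simplex_nonempty R J0; exists (fun=> b) => h. Qed.

Lemma normr_expected_payoff_le k (p : {ffun X -> R}) sigma tau :
  simplex R X p -> strategy1 R X I J sigma -> strategy2 R I J tau ->
  `|expected_payoff G k p sigma tau| <=
  \sum_x \sum_(h : k.-tuple (I * J))
     `|k%:R^-1 * \sum_(t < k) G x (tnth h t).1 (tnth h t).2|.
Proof.
move=> sp ssigma stau; rewrite /expected_payoff.
apply: le_trans (ler_norm_sum _ _ _) _; apply: ler_sum => x _.
apply: le_trans (ler_norm_sum _ _ _) _; apply: ler_sum => h _.
rewrite normrM ler_piMl // /play_prob normrM normr_prod.
apply: mulr_ile1 => //.
  by apply: prodr_ge0.
  by rewrite ger0_norm ?simplex_le1 //; apply: sp.1.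
apply: prodr_ile1 => t _; rewrite normr_ge0 /=.
have a0 := (ssigma x (take t h)).1; have b0 := (stau (take t h)).1.
rewrite ger0_norm ?mulr_ge0 // mulr_ile1 //; apply: simplex_le1.
  exact: ssigma.
exact: stau.
Qed.

Lemma has_inf_repeated_value k (p : {ffun X -> R}) sigma :
  simplex R X p -> strategy1 R X I J sigma ->
  has_inf [set expected_payoff G k p sigma tau | tau in strategy2 R I J].
Proof.
move=> sp; apply: (bounded_has_inf strategy2_nonempty) => s t.
exact: normr_expected_payoff_le.
Qed.

Lemma has_sup_repeated_value k (p : {ffun X -> R}) :
  simplex R X p ->
  has_sup [set inf [set expected_payoff G k p sigma tau
                   | tau in strategy2 R I J]
          | sigma in strategy1 R X I J].
Proof.
move=> sp; apply: (bounded_has_sup_inf strategy1_nonempty strategy2_nonempty).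
by move=> s t; exact: normr_expected_payoff_le.
Qed.

Lemma normr_mixed_payoff_le (q : {ffun X -> R}) a b :
  simplex R X q -> simplex R I a -> simplex R J b ->
  `|mixed_payoff G q a b| <= \sum_i \sum_j \sum_x `|G x i j|.
Proof.
move=> sq sa sb; rewrite /mixed_payoff.
apply: le_trans (ler_norm_sum _ _ _) _; apply: ler_sum => i _.
apply: le_trans (ler_norm_sum _ _ _) _; apply: ler_sum => j _.
have a0 := sa.1 i; have b0 := sb.1 j.
rewrite normrM; apply: (@le_trans _ _ `|\sum_x q x * G x i j|).
  by rewrite ler_piMl // ger0_norm ?mulr_ge0 // mulr_ile1 // simplex_le1.
apply: le_trans (ler_norm_sum _ _ _) _; apply: ler_sum => x _.
by rewrite normrM ler_piMl // ger0_norm ?simplex_le1 //; apply: sq.1.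
Qed.

Lemma has_sup_stage_value (q : {ffun X -> R}) b :
  simplex R X q -> simplex R J b ->
  has_sup [set mixed_payoff G q a b | a in simplex R I].
Proof.
move=> sq sb; apply: (bounded_has_sup (simplex_nonempty R I0) _ sb).
by move=> a t; exact: normr_mixed_payoff_le.
Qed.

Lemma has_inf_stage_value (q : {ffun X -> R}) :
  simplex R X q ->
  has_inf [set sup [set mixed_payoff G q a b | a in simplex R I]
          | b in simplex R J].
Proof.
move=> sq; apply: (bounded_has_inf_sup (simplex_nonempty R I0)).
  exact: simplex_nonempty.
by move=> a b; exact: normr_mixed_payoff_le.
Qed.

Lemma stage_value_le (q : {ffun X -> R}) :
  simplex R X q -> stage_value G q <= \sum_i \sum_j \sum_x `|G x i j|.
Proof.
move=> sq; apply: (bounded_inf_sup_le (simplex_nonempty R I0)).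
  exact: simplex_nonempty.
by move=> a b; exact: normr_mixed_payoff_le.
Qed.

End well_defined_values.

(* Main.v *)
Require Import Defs.
From mathcomp Require Import all_boot all_order all_algebra.
From mathcomp Require Import all_classical all_reals all_analysis.
From mathcomp Require Import measurable_realfun zify ring lra.
Import Order.TTheory GRing.Theory Num.Theory.

Set Implicit Arguments.
Unset Strict Implicit.
Unset Printing Implicit Defensive.

Local Open Scope ring_scope.

(** The gap between the value of the game and the concavification is compared
    with the maximal variation through the common order of magnitude
    [Num.sqrt (k * ln d)]: the variation is at most of this order, and there
    is a game whose [k]-stage value exceeds [cav u] by at least this order
    divided by [k].

    Upper bound on the variation ([max_variation_le]).  A martingale of
    probabilities moves at the expense of entropy.  Pointwise, a step from [p]
    to [q] satisfies, for every [l > 0],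
      [l * norm1 (q - p) <= entropy drop + noise + O (l ^+ 2)],
    where the noise is linear in [q - p] with coefficients depending on [p]
    alone ([norm1_le_entropy_drop]), so that its mean vanishes for a martingale
    ([mean_zero_cond_expectation]).  The total entropy drop is at most [ln d];
    summing over the [k] steps bounds the variation by a multiple of
    [k * l + ln d / l], and [l] remains to be chosen.  The logarithm is
    unbounded near the boundary of the simplex, hence the entropy is taken at
    the midpoint of [p] and the uniform probability.

    Lower bound on the value ([bit_value_ge]).  Let [n] be the integer part of
    the binary logarithm of [d].  The state is a word of [n] independent fair
    signs [theta b].  Player 1 names a position [b] and a sign [i]; player 2
    names a sign [j b] for each position; the payoff is [i * (theta b + j b)].
    If the public belief has means [y b], then player 2 gets an expected payoff
    [0] whatever player 1 does, by drawing [j b] independently with means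
    [- y b]; hence [u <= 0] and [cav u <= 0] ([bit_cav_le0]).
    Player 1 draws [b] uniformly, and [i] with conditional mean
    [e / 2 * (theta b - y b)].  Then [i] has mean [0] from the point of view of
    player 2, so that [j] does not influence the expected payoff, which is
    [e / 2] times the average of [1 - y b ^+ 2].  After the move, the belief is
    again a product, with only [y b] changed, by [i * (e / 2) * (1 - y b ^+ 2)]
    ([bits_prob_update]); so the sum of the [1 - y b ^+ 2], which is [n] at the
    start, loses on average at most [e ^+ 2 / 4] per stage.  With
    [e = Num.sqrt (n / k)] a constant proportion of it survives all [k] stages,
    and the average payoff is at least [3 / 8 * e].

    When [d = 1] both sides vanish, since nothing can be learnt. *)

(** * Random variables of mean zero *)

Definition mean_zero (R : realType) (disp : measure_display)
    (T : measurableType disp) (P : probability T R) (f : T -> R) : Prop :=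
  P.-integrable setT (EFin \o f) /\ (\int[P]_w (f w)%:E = 0)%E.

Lemma mean_zero0 (R : realType) (disp : measure_display)
    (T : measurableType disp) (P : probability T R) :
  mean_zero P (fun=> 0).
Proof. by split; [exact: integrable0|exact: integral0]. Qed.

Lemma mean_zeroD (R : realType) (disp : measure_display)
    (T : measurableType disp) (P : probability T R) (f g : T -> R) :
  mean_zero P f -> mean_zero P g -> mean_zero P (fun w => f w + g w).
Proof.
move=> [fi f0] [gi g0]; split; first exact: (integrableD measurableT fi gi).
under eq_integral do rewrite EFinD.
by rewrite integralD_EFin // f0 g0 adde0.
Qed.

Lemma mean_zeroZ (R : realType) (disp : measure_display)
    (T : measurableType disp) (P : probability T R) (c : R) (f : T -> R) :
  mean_zero P f -> mean_zero P (fun w => c * f w).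
Proof.
move=> [fi f0]; split; first exact: (integrableZl measurableT c fi).
under eq_integral do rewrite EFinM.
by rewrite integralZl // f0 mule0.
Qed.

Lemma mean_zero_sum (R : realType) (disp : measure_display)
    (T : measurableType disp) (P : probability T R) (I : Type) (s : seq I)
    (p : pred I) (f : I -> T -> R) :
  (forall i, p i -> mean_zero P (f i)) ->
  mean_zero P (fun w => \sum_(i <- s | p i) f i w).
Proof.
move=> H; elim: s => [|i s IH].
  have -> : (fun w => \sum_(i <- [::] | p i) f i w) = (fun=> 0).
    by apply/funext => w; rewrite big_nil.
  exact: mean_zero0.
have -> : (fun w => \sum_(i <- i :: s | p i) f i w) =
    (fun w => (if p i then f i w else 0) + \sum_(i <- s | p i) f i w).
  by apply/funext => w; rewrite big_cons; case: ifP; rewrite ?add0r.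
apply: mean_zeroD => //; case pi : (p i); last exact: mean_zero0.
exact: H.
Qed.

Lemma bounded_integrable (R : realType) (disp : measure_display)
    (T : measurableType disp) (P : probability T R) (f : T -> R) (C : R) :
  measurable_fun setT f -> (forall w, `|f w| <= C) ->
  P.-integrable setT (EFin \o f).
Proof.
move=> mf fC; apply: measurable_bounded_integrable => //.
  by apply: le_lt_trans (ltry 1); exact: probability_le1.
exists C; split; first exact: num_real.
by move=> M CM w _; apply: le_trans (fC w) (ltW CM).
Qed.

(** Layer cake, discretised: counting the levels [1, .., M] below [x] gives the
    integer part of [x]. *)
Lemma sum_level_indicators (R : realType) (x : R) (M : nat) :
  0 <= x <= M%:R -> x - 1 <= \sum_(i < M) (i.+1%:R <= x :> R)%R%:R <= x.
Proof.
elim: M x => [|M IH] x /andP[x0 xM].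
  by rewrite big_ord0 x0 lerBlDr add0r (le_trans xM).
rewrite big_ord_recr /=; have [xM'|Mx] := leP x M%:R.
  rewrite [_ <= x]lt_geF ?addr0; first by rewrite IH ?x0.
  by rewrite (le_lt_trans xM') // ltr_nat.
rewrite (eq_bigr (fun=> 1)) => [|i _]; last first.
  by rewrite (le_trans _ (ltW Mx)) // ler_nat.
rewrite sumr_const card_ord; case: (boolP (M.+1%:R <= x)) => /= [Mx'|_].
  by rewrite -natr1 in Mx'; rewrite -natr1 in xM; apply/andP; split; lra.
by rewrite -natr1 in xM; apply/andP; split; lra.
Qed.

(** The level sets of a function of [Z] are preimages under [Z], hence events of
    the conditioning sigma-algebra, over which [Y] and [Z] have the same
    integral. *)
Lemma cond_expectation_level (R : realType) (disp : measure_display)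
    (T : measurableType disp) (P : probability T R) (F : set (set T))
    (Y Z : T -> R) (phi : R -> R) (c : R) :
  is_cond_expectation P F Y Z -> P.-integrable setT (EFin \o Y) ->
  measurable_fun setT Z -> measurable_fun setT phi ->
  mean_zero P (fun w => (c <= phi (Z w))%R%:R * (Y w - Z w)).
Proof.
move=> [FZ Zi YZ] Yi mZ mphi.
pose A := [set w | c <= phi (Z w)]%classic.
have AE : A = (Z @^-1` (phi @^-1` [set y | c <= y]))%classic by [].
have mB : measurable (phi @^-1` [set y | c <= y])%classic.
  rewrite -[X in measurable X]setTI; apply: mphi => //.
  rewrite (_ : [set y | _]%classic = `[c, +oo[%classic) //.
  by apply/seteqP; split=> y /=; rewrite in_itv /= andbT.
have FA : F A := FZ _ mB.
have mA : measurable A by rewrite AE -[X in measurable X]setTI; exact: mZ.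
have E : (fun w => (c <= phi (Z w))%R%:R * (Y w - Z w)) =
    ((fun w => Y w - Z w) \_ A)%R.
  apply/funext => w; rewrite /patch.
  have -> : (w \in A) = (c <= phi (Z w))%R.
    by apply/idP/idP => [/set_mem|wA]; [|apply/mem_set].
  by case: (c <= _); rewrite ?mul1r ?mul0r.
have YZi : P.-integrable setT (EFin \o (fun w => Y w - Z w)).
  exact: (integrableB measurableT Yi Zi).
rewrite /mean_zero E; split.
  rewrite -restrict_EFin; apply/(integrable_mkcond _ mA).
  exact: (integrableS measurableT mA (@subsetT _ A) YZi).
have YA := integrableS measurableT mA (@subsetT _ A) Yi.
have ZA := integrableS measurableT mA (@subsetT _ A) Zi.
have -> : (fun w => ((c <= phi (Z w))%R%:R * (Y w - Z w))%:E) =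
    EFin \o ((fun w => Y w - Z w) \_ A) by rewrite -E.
rewrite -restrict_EFin -integral_mkcond.
under eq_integral do rewrite /= EFinB.
rewrite integralB_EFin // (YZ _ FA) subee //; exact: (integrable_fin_num mA YA).
Qed.

(** A conditional expectation is orthogonal to bounded functions of itself: up to
    a uniform error [d], [phi (Z w)] is [d] times the number of levels
    [d, 2 * d, ..] that it exceeds, and each level contributes [0]. *)
Lemma mean_zero_cond_expectation (R : realType) (disp : measure_display)
    (T : measurableType disp) (P : probability T R) (F : set (set T))
    (Y Z : T -> R) (phi : R -> R) (K : R) :
  is_cond_expectation P F Y Z ->
  measurable_fun setT Y -> measurable_fun setT Z -> measurable_fun setT phi ->
  (forall w, 0 <= Y w <= 1) -> (forall w, 0 <= Z w <= 1) ->
  (forall w, 0 <= phi (Z w) <= K) ->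
  mean_zero P (fun w => phi (Z w) * (Y w - Z w)).
Proof.
move=> YZ mY mZ mphi Y01 Z01 phiK.
have Yi : P.-integrable setT (EFin \o Y).
  apply: (@bounded_integrable _ _ _ _ _ 1) => // w.
  by case/andP: (Y01 w) => ? ?; rewrite ger0_norm.
have D1 w : `|Y w - Z w| <= 1.
  have /andP[Y0 Y1] := Y01 w; have /andP[Z0 Z1] := Z01 w.
  by rewrite ler_norml; apply/andP; split; lra.
have mphiZ : measurable_fun setT (phi \o Z) by exact: measurableT_comp.
have mD : measurable_fun setT (fun w => Y w - Z w) by exact: measurable_funB.
have gi : P.-integrable setT (EFin \o (fun w => phi (Z w) * (Y w - Z w))).
  apply: (@bounded_integrable _ _ _ _ _ K); first exact: measurable_funM.
  move=> w; have /andP[p0 pK] := phiK w.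
  rewrite normrM ger0_norm //; apply: le_trans pK.
  by rewrite ler_piMr.
split=> //; pose r := \int[P]_w (phi (Z w) * (Y w - Z w)).
suff r0 : r = 0.
  rewrite -[RHS]/(0%:E) -r0 /r /Rintegral fineK //.
  exact: (integrable_fin_num measurableT gi).
apply/eqP; rewrite -normr_le0; apply/ler_addgt0Pr => d d0; rewrite add0r.
pose M := (Num.truncn (K / d)).+1.
pose step w := d * \sum_(i < M) (i.+1%:R * d <= phi (Z w))%R%:R * (Y w - Z w).
have [si s0] : mean_zero P step.
  apply: mean_zeroZ; apply: mean_zero_sum => i _.
  exact: cond_expectation_level YZ Yi mZ mphi.
have si0 : \int[P]_w step w = 0 by rewrite /Rintegral s0.
have close w : `|phi (Z w) * (Y w - Z w) - step w| <= d.
  rewrite /step -mulr_suml mulrA -mulrBl normrM -[leRHS]mulr1.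
  apply: ler_pM => //.
  under eq_bigr do rewrite -ler_pdivlMr //.
  have /andP[p0 pK] := phiK w.
  have xM : phi (Z w) / d <= M%:R.
    apply: le_trans (ltW (Num.Theory.truncnS_gt _)).
    by rewrite ler_pM2r ?invr_gt0.
  have := @sum_level_indicators R (phi (Z w) / d) M.
  rewrite xM divr_ge0 ?(ltW d0) // => /(_ isT) /andP[lo hi].
  have e : phi (Z w) = d * (phi (Z w) / d) by rewrite mulrC divfK // gt_eqF.
  rewrite {1}e -mulrBr normrM gtr0_norm // ler_piMr ?(ltW d0) //.
  by rewrite ler_norml; apply/andP; split; lra.
have di : P.-integrable setT
    (EFin \o (fun w => phi (Z w) * (Y w - Z w) - step w)).
  exact: (integrableB measurableT gi si).
have -> : r = \int[P]_w (phi (Z w) * (Y w - Z w) - step w).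
  by rewrite RintegralB // si0 subr0.
apply: le_trans (le_normr_Rintegral measurableT di) _.
have -> : d = \int[P]_(w in setT) d.
  rewrite Rintegral_cst // (_ : fine _ = 1) ?mulr1 //.
  exact: (congr1 fine (probability_setT P)).
apply: le_Rintegral => //; first exact: integrable_norm.
exact: finite_measure_integrable_cst.
Qed.

(** * Entropy bounds the variation *)

Lemma ln_ge1BV (R : realType) (x : R) : 0 < x -> 1 - x^-1 <= ln x.
Proof.
move=> x0; have xV : 0 < x^-1 by rewrite invr_gt0.
have := @le_ln1Dx R (x^-1 - 1).
by rewrite [1 + _]addrC subrK lnV ?posrE // ltrBrDr addrC subrr => /(_ xV); lra.
Qed.

(** The right-hand side is the gap between [x * ln x] at [b] and its tangent at
    [a].  It is at least [(Num.sqrt b - Num.sqrt a) ^+ 2] (the Hellinger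
    distance bounds the relative entropy from below), while
    [`|b - a| = `|Num.sqrt b - Num.sqrt a| * (Num.sqrt b + Num.sqrt a)], so
    that the arithmetic-geometric inequality gives the bound. *)
Lemma xlnx_bregman_ge (R : realType) (a b l : R) :
  0 < a -> 0 < b -> 0 <= l ->
  l * `|b - a| - l ^+ 2 * ((a + b) / 2) <=
  b * ln b - a * ln a - (ln a + 1) * (b - a).
Proof.
move=> a0 b0 l0.
have [s s0 ->] : exists2 s : R, 0 < s & a = s ^+ 2.
  by exists (Num.sqrt a); rewrite ?sqrtr_gt0 ?sqr_sqrtr // ltW.
have [t t0 ->] : exists2 t : R, 0 < t & b = t ^+ 2.
  by exists (Num.sqrt b); rewrite ?sqrtr_gt0 ?sqr_sqrtr // ltW.
rewrite !lnXn //.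
have ts : t * (t - s) <= t ^+ 2 * (ln t - ln s).
  have := ln_ge1BV (divr_gt0 t0 s0); rewrite ln_div ?posrE // => h.
  rewrite (_ : t * (t - s) = t ^+ 2 * (1 - (t / s)^-1)); last first.
    by field; rewrite !gt_eqF.
  by apply: ler_wpM2l => //; exact: sqr_ge0.
have hellinger : l * `|t ^+ 2 - s ^+ 2| <=
    (t - s) ^+ 2 + l ^+ 2 * ((s ^+ 2 + t ^+ 2) / 2).
  rewrite subr_sqr normrM [`|t + s|]gtr0_norm ?addr_gt0 //.
  rewrite -[(t - s) ^+ 2]real_normK ?num_real //.
  have := sqr_ge0 (`|t - s| - l * (t + s) / 2).
  have := sqr_ge0 (l * (t - s)).
  by lra.
by lra.
Qed.

(** The midpoint of [p] and the uniform probability, whose coordinates are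
    bounded away from [0]. *)
Definition smooth (R : realType) (X : finType) (p : {ffun X -> R}) (x : X) : R :=
  (p x + #|X|%:R^-1) / 2.

Definition smooth_entropy (R : realType) (X : finType) (p : {ffun X -> R}) : R :=
  - \sum_x smooth p x * ln (smooth p x).

Lemma card_simplex_gt0 (R : realType) (X : finType) (p : {ffun X -> R}) :
  simplex R X p -> (0 < #|X|)%N.
Proof.
move=> [_ p1]; rewrite lt0n; apply/eqP => X0; move/eqP: p1.
rewrite big1 => [|x _]; first by rewrite eq_sym oner_eq0.
by have := max_card (pred1 x); rewrite X0 card1.
Qed.

Lemma smooth_itv (R : realType) (X : finType) (p : {ffun X -> R}) x :
  simplex R X p -> 0 < (2 * #|X|%:R)^-1 :> R /\
  (2 * #|X|%:R)^-1 <= smooth p x <= 1.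
Proof.
move=> sp; have X0 : 0 < #|X|%:R :> R by rewrite ltr0n (card_simplex_gt0 sp).
have X1 : #|X|%:R^-1 <= 1 :> R by rewrite invf_le1 // ler1n (card_simplex_gt0 sp).
have := sp.1 x; have := simplex_le1 x sp.
rewrite invfM mulr_gt0 ?invr_gt0 // /smooth => p1 p0; split=> //.
by apply/andP; split; lra.
Qed.

Lemma smooth_gt0 (R : realType) (X : finType) (p : {ffun X -> R}) x :
  simplex R X p -> 0 < smooth p x.
Proof. by move=> /(@smooth_itv _ _ _ x) [c0 /andP[/(lt_le_trans c0)]]. Qed.

Lemma sum_smooth (R : realType) (X : finType) (p : {ffun X -> R}) :
  simplex R X p -> \sum_x smooth p x = 1.
Proof.
move=> sp; have X0 : #|X|%:R != 0 :> R.
  by rewrite pnatr_eq0 -lt0n (card_simplex_gt0 sp).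
rewrite -mulr_suml big_split /= sp.2 sumr_const -[X in _ + X]mulr_natl mulfV //.
by field.
Qed.

Lemma smooth_entropy_ge0 (R : realType) (X : finType) (p : {ffun X -> R}) :
  simplex R X p -> 0 <= smooth_entropy p.
Proof.
move=> sp; rewrite oppr_ge0; apply: sumr_le0 => x _.
have [_ /andP[_ s1]] := smooth_itv x sp.
by apply: mulr_ge0_le0; [exact/ltW/smooth_gt0|exact: ln_le0].
Qed.

(** The gap is the relative entropy of [smooth p] with respect to the uniform
    probability, and [ln z >= 1 - z^-1]. *)
Lemma smooth_entropy_le (R : realType) (X : finType) (p : {ffun X -> R}) :
  simplex R X p -> smooth_entropy p <= ln #|X|%:R.
Proof.
move=> sp; have X0 : 0 < #|X|%:R :> R by rewrite ltr0n (card_simplex_gt0 sp).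
have -> : ln #|X|%:R = \sum_x smooth p x * ln #|X|%:R.
  by rewrite -mulr_suml (sum_smooth sp) mul1r.
rewrite -subr_ge0 /smooth_entropy -sumrN -sumrB.
have e : \sum_x (smooth p x - #|X|%:R^-1) = 0.
  rewrite sumrB (sum_smooth sp) sumr_const -[X in _ - X]mulr_natl mulfV ?subrr //.
  by rewrite gt_eqF.
rewrite -[leLHS]e; apply: ler_sum => x _; have s0 := smooth_gt0 x sp.
have := ln_ge1BV (mulr_gt0 s0 X0); rewrite lnM ?posrE // => h.
have -> : smooth p x - #|X|%:R^-1 = smooth p x * (1 - (smooth p x * #|X|%:R)^-1).
  by field; rewrite !gt_eqF.
rewrite opprK -mulrDr [leRHS]mulrC [ln #|X|%:R + _]addrC [leRHS]mulrC.
exact: ler_wpM2l (ltW s0) _ _ h.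
Qed.

(** Sum over [x] of [xlnx_bregman_ge], at the smoothed coordinates.  The last
    term is linear in [q] and vanishes at [q = p]; it averages to [0] along a
    martingale. *)
Lemma norm1_le_entropy_drop (R : realType) (X : finType)
    (p q : {ffun X -> R}) (l : R) :
  simplex R X p -> simplex R X q -> 0 <= l ->
  l / 2 * norm1 (q - p) - l ^+ 2 <=
  smooth_entropy p - smooth_entropy q
    + 2^-1 * \sum_x - ln (smooth p x) * (q x - p x).
Proof.
move=> sp sq l0.
have E x : smooth q x - smooth p x = (q x - p x) / 2 by rewrite /smooth; lra.
have -> : l / 2 * norm1 (q - p) - l ^+ 2 =
    \sum_x (l * `|smooth q x - smooth p x|
            - l ^+ 2 * ((smooth p x + smooth q x) / 2)).
  rewrite sumrB -!mulr_sumr -mulr_suml big_split /= !sum_smooth //.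
  congr (_ - _); last by lra.
  rewrite -mulrA; congr (_ * _); rewrite /norm1 mulr_sumr; apply: eq_bigr => x _.
  by rewrite E !ffunE normrM [`|2^-1|]gtr0_norm ?invr_gt0 // mulrC.
have -> : smooth_entropy p - smooth_entropy q
      + 2^-1 * \sum_x - ln (smooth p x) * (q x - p x) =
    \sum_x (smooth q x * ln (smooth q x) - smooth p x * ln (smooth p x)
      - (ln (smooth p x) + 1) * (smooth q x - smooth p x)).
  have z : \sum_x (smooth q x - smooth p x) = 0.
    by rewrite sumrB !sum_smooth // subrr.
  rewrite -[LHS]subr0 -[X in _ - X]z /smooth_entropy -!sumrN mulr_sumr.
  rewrite -!big_split /=; apply: eq_bigr => x _; rewrite E; lra.
by apply: ler_sum => x _; apply: xlnx_bregman_ge => //; exact: smooth_gt0.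
Qed.

Lemma measurable_norm1_diff (R : realType) (disp : measure_display)
    (T : measurableType disp) (X : finType) (u v : T -> {ffun X -> R}) :
  (forall x, measurable_fun setT (fun w => u w x)) ->
  (forall x, measurable_fun setT (fun w => v w x)) ->
  measurable_fun setT (fun w => norm1 (u w - v w)).
Proof.
move=> mu mv; apply: measurable_sum => x.
under eq_fun do rewrite !ffunE.
by apply: measurableT_comp => //; exact: measurable_funB.
Qed.

(** The entropy drops telescope along the path, and the entropy stays between [0]
    and [ln #|X|%:R]; the accumulated noise has mean zero. *)
Lemma variation_le (R : realType) (disp : measure_display)
    (T : measurableType disp) (P : probability T R) (X : finType) (k : nat)
    (p : {ffun X -> R}) (m : nat -> T -> {ffun X -> R}) (l : R) :
  martingale P k p m -> 0 < l ->
  (Defs.variation P k m <= (2 * (k%:R * l + ln #|X|%:R / l))%:E)%E.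
Proof.
move=> [ms _ mm mc] l0.
pose psi (z : R) : R := - ln ((z + #|X|%:R^-1) / 2).
pose noise w := l^-1 * \sum_(0 <= t < k) \sum_x
   psi (m t w x) * (m t.+1 w x - m t w x).
have mpsi : measurable_fun setT psi.
  apply: measurableT_comp => //; apply: measurableT_comp.
    exact: measurable_ln.
  apply: measurable_funM => //; exact: measurable_funD.
have m01 t w x : (t <= k)%N -> 0 <= m t w x <= 1.
  by move=> /ms -/(_ w) sm; rewrite sm.1 simplex_le1.
have noise0 : mean_zero P noise.
  apply: mean_zeroZ; rewrite (_ : (fun w => _) = fun w => \sum_(t < k) \sum_x
     psi (m t w x) * (m t.+1 w x - m t w x)); last first.
    by apply/funext => w; rewrite big_mkord.
  apply: mean_zero_sum => t _; apply: mean_zero_sum => x _.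
  apply: (@mean_zero_cond_expectation _ _ _ _ (history m t) _ _ psi
    (- ln (2 * #|X|%:R)^-1)).
  - exact: mc.
  - exact: mm.
  - by apply: mm; exact: ltnW.
  - exact: mpsi.
  - by move=> w; exact: m01.
  - by move=> w; apply: m01; exact: ltnW.
  move=> w; have st := ms t w (ltnW (ltn_ord t)).
  have [c0 /andP[lo hi]] := smooth_itv x st.
  rewrite /psi -/(smooth (m t w) x) oppr_ge0 lerN2 ln_le0 //=.
  by rewrite ler_ln ?posrE //; exact: lt_le_trans lo.
set c := 2 * _; pose f w := \sum_(0 <= t < k) norm1 (m t.+1 w - m t w).
have fle w : f w <= c + noise w.
  have steps j : (j <= k)%N ->
      l / 2 * \sum_(0 <= t < j) norm1 (m t.+1 w - m t w) - j%:R * l ^+ 2 <=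
      smooth_entropy (m 0%N w) - smooth_entropy (m j w) +
      2^-1 * \sum_(0 <= t < j) \sum_x psi (m t w x) * (m t.+1 w x - m t w x).
    elim: j => [|j IH] jk; first by rewrite !big_geq // !mulr0 mul0r !subrr addr0.
    rewrite !big_nat_recr //= -[j.+1%:R]natr1.
    have := IH (ltnW jk).
    have : l / 2 * norm1 (m j.+1 w - m j w) - l ^+ 2 <=
        smooth_entropy (m j w) - smooth_entropy (m j.+1 w) +
        2^-1 * \sum_x psi (m j w x) * (m j.+1 w x - m j w x).
      exact: norm1_le_entropy_drop (ms j w (ltnW jk)) (ms j.+1 w jk) (ltW l0).
    by lra.
  have := steps k (leqnn k); rewrite -/(f w).
  have := smooth_entropy_le (ms 0%N w (leq0n k)).
  have := smooth_entropy_ge0 (ms k w (leqnn k)).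
  rewrite /noise; set A := \sum_(0 <= t < k) _ => h1 h2 h3.
  rewrite -(@ler_pM2l _ (l / 2)) ?divr_gt0 //.
  rewrite (_ : l / 2 * (c + l^-1 * A) = k%:R * l ^+ 2 + ln #|X|%:R + 2^-1 * A).
    by lra.
  by rewrite /c; field; rewrite gt_eqF.
have [ni n0] := noise0.
have fi : measurable_fun setT f.
  rewrite /f; under eq_fun do rewrite big_nat.
  rewrite (_ : (fun w => _) = fun w => \sum_(t < k) norm1 (m t.+1 w - m t w)).
    apply: measurable_sum => t; apply: measurable_norm1_diff => x; apply: mm => //.
    exact: ltnW.
  by apply/funext => w; rewrite -big_nat big_mkord.
have f0 w : 0 <= f w.
  by apply: sumr_ge0 => t _; apply: sumr_ge0 => x _.
have ci := finite_measure_integrable_cst P c measurableT.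
rewrite /Defs.variation unlock -/f.
have -> : c%:E = (\int[P]_w (c + noise w)%:E)%E.
  under eq_integral do rewrite EFinD.
  rewrite integralD_EFin // n0 adde0 integral_cst //.
  rewrite [X in (_ * X)%E](_ : _ = 1%E) ?mule1 //.
  exact: (probability_setT P).
apply: ge0_le_integral => //.
- by move=> w _; exact: f0.
- exact/measurable_EFinP.
- exact: measurable_int (integrableD measurableT ci ni).
- by move=> w _; exact: fle.
Qed.

Lemma max_variation_le (R : realType) (k d : nat) (l : R) :
  0 < l -> (max_variation R k d <= (2 * (k%:R * l + ln d%:R / l))%:E)%E.
Proof.
move=> l0; apply: ge_ereal_sup => _ [X [p [<- sp ->]]].
apply: ge_ereal_sup => _ [disp [T [P [m [mart ->]]]]].
exact: variation_le mart l0.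
Qed.

(** * Repeated games *)

Lemma sum_prod (V : nmodType) (A B : finType) (F : A * B -> V) :
  \sum_c F c = \sum_a \sum_b F (a, b).
Proof. by rewrite pair_bigA; apply: eq_bigr => -[]. Qed.

Lemma sum_tuple_cons (V : nmodType) (T : finType) (r : nat)
    (F : r.+1.-tuple T -> V) :
  \sum_h F h = \sum_a \sum_(h : r.-tuple T) F [tuple of a :: h].
Proof.
rewrite pair_big /= (reindex (fun q : T * r.-tuple T => [tuple of q.1 :: q.2])) //=.
exists (fun h => (thead h, [tuple of behead h])) => [[a h] _|h _] /=.
  by congr pair; apply: val_inj.
by rewrite [RHS]tuple_eta.
Qed.

(** The conditional probability, given the state [x] and the past [h], that the
    next [r] action pairs are [h']. *)
Definition continuation_prob (R : realType) (X I J : finType)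
    (sigma : X -> seq (I * J) -> {ffun I -> R})
    (tau : seq (I * J) -> {ffun J -> R}) (h : seq (I * J)) (x : X) (r : nat)
    (h' : r.-tuple (I * J)) : R :=
  \prod_(t < r) (sigma x (h ++ take t h') (tnth h' t).1
                 * tau (h ++ take t h') (tnth h' t).2).

Lemma continuation_prob_cons (R : realType) (X I J : finType)
    (sigma : X -> seq (I * J) -> {ffun I -> R})
    (tau : seq (I * J) -> {ffun J -> R}) (h : seq (I * J)) (x : X) (r : nat)
    (a : I * J) (h' : r.-tuple (I * J)) :
  continuation_prob sigma tau h x [tuple of a :: h'] =
  sigma x h a.1 * tau h a.2 * continuation_prob sigma tau (rcons h a) x h'.
Proof.
rewrite /continuation_prob big_ord_recl take0 cats0 tnth0; congr (_ * _).
by apply: eq_bigr => t _; rewrite tnthS /= -cat_rcons.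
Qed.

Lemma sum_continuation_prob (R : realType) (X I J : finType)
    (sigma : X -> seq (I * J) -> {ffun I -> R})
    (tau : seq (I * J) -> {ffun J -> R}) (h : seq (I * J)) (x : X) (r : nat) :
  strategy1 R X I J sigma -> strategy2 R I J tau ->
  \sum_(h' : r.-tuple (I * J)) continuation_prob sigma tau h x h' = 1.
Proof.
move=> s1 s2; elim: r h => [|r IH] h.
  rewrite (big_pred1 [tuple]) => [|t]; last by rewrite [t]tuple0 /= eqxx.
  by rewrite /continuation_prob big_ord0.
rewrite sum_tuple_cons; under eq_bigr => a _.
  under eq_bigr => h' _ do rewrite continuation_prob_cons.
  rewrite -mulr_sumr IH mulr1.
over.
rewrite -(pair_bigA _ (fun i j => sigma x h i * tau h j)) /=.
under eq_bigr => i _ do rewrite -mulr_sumr (s2 h).2 mulr1.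
exact: (s1 x h).2.
Qed.

(** The weights [w] stand for the joint probabilities of the state and the past
    [h], up to a constant factor; working with unnormalised weights avoids
    dividing by the probability of [h]. *)
Definition continuation_payoff (R : realType) (X I J : finType)
    (G : X -> I -> J -> R)
    (sigma : X -> seq (I * J) -> {ffun I -> R})
    (tau : seq (I * J) -> {ffun J -> R}) (r : nat) (w : X -> R)
    (h : seq (I * J)) : R :=
  \sum_x \sum_(h' : r.-tuple (I * J))
    w x * continuation_prob sigma tau h x h' *
    \sum_(t < r) G x (tnth h' t).1 (tnth h' t).2.

Lemma expected_payoffE (R : realType) (X I J : finType)
    (G : X -> I -> J -> R) (k : nat) (p : {ffun X -> R})
    (sigma : X -> seq (I * J) -> {ffun I -> R})
    (tau : seq (I * J) -> {ffun J -> R}) :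
  expected_payoff G k p sigma tau =
  k%:R^-1 * continuation_payoff G sigma tau k p [::].
Proof.
rewrite /expected_payoff /continuation_payoff mulr_sumr.
apply: eq_bigr => x _; rewrite mulr_sumr; apply: eq_bigr => h _.
by rewrite mulrCA.
Qed.

Lemma continuation_payoff0 (R : realType) (X I J : finType)
    (G : X -> I -> J -> R) (sigma : X -> seq (I * J) -> {ffun I -> R})
    (tau : seq (I * J) -> {ffun J -> R}) (w : X -> R) (h : seq (I * J)) :
  continuation_payoff G sigma tau 0 w h = 0.
Proof.
by rewrite /continuation_payoff big1 // => x _; rewrite big1 // => h' _;
  rewrite big_ord0 mulr0.
Qed.

(** Dynamic programming: the weights after a stage are those before it times the
    likelihood of the observed action of player 1. *)
Lemma continuation_payoffS (R : realType) (X I J : finType)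
    (G : X -> I -> J -> R) (sigma : X -> seq (I * J) -> {ffun I -> R})
    (tau : seq (I * J) -> {ffun J -> R}) (r : nat) (w : X -> R)
    (h : seq (I * J)) :
  strategy1 R X I J sigma -> strategy2 R I J tau ->
  continuation_payoff G sigma tau r.+1 w h =
  \sum_i \sum_j tau h j *
    (\sum_x w x * sigma x h i * G x i j +
     continuation_payoff G sigma tau r (fun x => w x * sigma x h i)
       (rcons h (i, j))).
Proof.
move=> s1 s2; rewrite pair_bigA /= /continuation_payoff.
rewrite (eq_bigr _ (fun x _ => sum_tuple_cons _)) exchange_big /=.
apply: eq_bigr => -[i j] _ /=.
rewrite -big_split mulr_sumr /=; apply: eq_bigr => x _.
rewrite -[X in X * G _ _ _]mulr1.
rewrite -{1}(sum_continuation_prob (rcons h (i, j)) x r s1 s2).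
rewrite mulr_sumr mulr_suml -big_split mulr_sumr /=; apply: eq_bigr => h' _.
rewrite continuation_prob_cons big_ord_recl tnth0 /=.
under eq_bigr => t _ do rewrite tnthS.
by ring.
Qed.

Lemma continuation_payoffZ (R : realType) (X I J : finType)
    (G : X -> I -> J -> R) (sigma : X -> seq (I * J) -> {ffun I -> R})
    (tau : seq (I * J) -> {ffun J -> R}) (r : nat) (c : R) (w : X -> R)
    (h : seq (I * J)) :
  continuation_payoff G sigma tau r (fun x => c * w x) h =
  c * continuation_payoff G sigma tau r w h.
Proof.
rewrite /continuation_payoff mulr_sumr; apply: eq_bigr => x _.
by rewrite mulr_sumr; apply: eq_bigr => h' _; rewrite !mulrA.
Qed.

Lemma repeated_value_ge (R : realType) (X I J : finType)
    (G : X -> I -> J -> R) (k : nat) (p : {ffun X -> R})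
    (sigma : X -> seq (I * J) -> {ffun I -> R}) (c : R) :
  (0 < #|I|)%N -> (0 < #|J|)%N -> simplex R X p -> strategy1 R X I J sigma ->
  (forall tau, strategy2 R I J tau -> c <= expected_payoff G k p sigma tau) ->
  c <= repeated_value G k p.
Proof.
move=> I0 J0 sp s1 H.
apply: (@le_trans _ _ (inf [set expected_payoff G k p sigma tau
    | tau in strategy2 R I J])%classic).
  apply: lb_le_inf; first by case: (has_inf_repeated_value G J0 k sp s1).
  by move=> _ [tau s2 <-]; exact: H.
apply: ub_le_sup; last by exists sigma.
by case: (has_sup_repeated_value G I0 J0 k sp).
Qed.

(** If player 2 can hold the stage payoff down to [c] at every belief, then the
    constant [c] is a concave majorant of the stage value. *)
Lemma cav_stage_value_le (R : realType) (X I J : finType)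
    (G : X -> I -> J -> R) (c : R) (q : {ffun X -> R}) :
  (0 < #|I|)%N -> (0 < #|J|)%N -> simplex R X q ->
  (forall q, simplex R X q -> exists2 b, simplex R J b &
     forall a, simplex R I a -> mixed_payoff G q a b <= c) ->
  cav (stage_value G) q <= c.
Proof.
move=> I0 J0 sq H.
apply: (@cav_le _ _ _ (fun=> c)) => //; split=> [q1 q2 l _ _ _|q' sq'].
  by rewrite -mulrDl addrC subrK mul1r.
have [b sb Hb] := H _ sq'.
apply: (@le_trans _ _ (sup [set mixed_payoff G q' a b | a in simplex R I])%classic).
  apply: ge_inf; last by exists b.
  by case: (has_inf_stage_value G I0 J0 sq').
apply: ge_sup; last by move=> _ [a sa <-]; exact: Hb.
by case: (has_sup_stage_value G I0 sq' sb).
Qed.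

Lemma expected_payoff_cst (R : realType) (X I J : finType) (c : R) (k : nat)
    (p : {ffun X -> R}) sigma tau :
  (0 < k)%N -> simplex R X p ->
  strategy1 R X I J sigma -> strategy2 R I J tau ->
  expected_payoff (fun _ _ _ => c) k p sigma tau = c.
Proof.
move=> k0 sp s1 s2; rewrite /expected_payoff.
under eq_bigr => x _.
  under eq_bigr => h _.
    rewrite sumr_const card_ord -[c *+ k]mulr_natl mulKf ?pnatr_eq0 -?lt0n //.
    rewrite /play_prob mulrAC.
  over.
  rewrite -mulr_sumr (sum_continuation_prob [::] x k s1 s2) mulr1.
over.
by rewrite -mulr_suml sp.2 mul1r.
Qed.

Lemma mixed_payoff_cst (R : realType) (X I J : finType) (c : R)
    (q : {ffun X -> R}) (a : {ffun I -> R}) (b : {ffun J -> R}) :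
  simplex R X q -> simplex R I a -> simplex R J b ->
  mixed_payoff (fun _ _ _ => c) q a b = c.
Proof.
move=> sq sa sb; rewrite /mixed_payoff -mulr_suml sq.2 mul1r.
under eq_bigr => i _ do rewrite -mulr_suml -mulr_sumr sb.2 mulr1.
by rewrite -mulr_suml sa.2 mul1r.
Qed.

(** * The game of hidden bits *)

(** The law of independent signs [(-1) ^+ f b] with means [y b]. *)
Definition bits_prob (R : realType) (n : nat) (y : 'I_n -> R)
    (f : {ffun 'I_n -> bool}) : R :=
  \prod_b ((1 + (-1) ^+ f b * y b) / 2).

Lemma bits_prob_ge0 (R : realType) (n : nat) (y : 'I_n -> R) f :
  (forall b, `|y b| <= 1) -> 0 <= bits_prob y f.
Proof.
move=> y1; apply: prodr_ge0 => b _; apply: divr_ge0 => //.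
have := y1 b; rewrite ler_norml => /andP[ym yM].
by case: (f b); rewrite ?expr1 ?expr0; lra.
Qed.

Lemma sum_bits_prob (R : realType) (n : nat) (y : 'I_n -> R) :
  \sum_f bits_prob y f = 1.
Proof.
rewrite -(bigA_distr_bigA (fun b (s : bool) => (1 + (-1) ^+ s * y b) / 2)) /=.
rewrite big1 // => b _; rewrite big_bool /= expr1 expr0; by field.
Qed.

Lemma mean_bits_prob (R : realType) (n : nat) (y : 'I_n -> R) (b : 'I_n) :
  \sum_f bits_prob y f * (-1) ^+ f b = y b.
Proof.
pose F c (s : bool) :=
  (1 + (-1) ^+ s * y c) / 2 * (if c == b then (-1) ^+ s else 1).
have -> : \sum_f bits_prob y f * (-1) ^+ f b =
    \sum_(f : {ffun 'I_n -> bool}) \prod_c F c (f c).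
  apply: eq_bigr => f _; rewrite big_split /=; congr (_ * _).
  by rewrite -big_mkcond big_pred1_eq.
rewrite -bigA_distr_bigA (bigD1 b) //=.
rewrite [X in _ * X]big1 => [|c /negPf cb].
  by rewrite mulr1 /F eqxx big_bool /= expr1 expr0; by field.
by rewrite /F cb big_bool /= expr1 expr0; by field.
Qed.

(** The new means of the signs when the sign [i.2] is observed at the position
    [i.1]; the parameter [e] measures how much player 1 reveals. *)
Definition update (R : realType) (n : nat) (e : R) (y : 'I_n -> R)
    (i : 'I_n * bool) : 'I_n -> R :=
  fun c => if c == i.1 then y c + (-1) ^+ i.2 * (e / 2) * (1 - y c ^+ 2)
           else y c.

Lemma onem_sqr_ge0 (R : realDomainType) (y : R) : `|y| <= 1 -> 0 <= 1 - y ^+ 2.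
Proof. by move=> y1; rewrite subr_ge0 -real_normK ?num_real // exprn_ile1. Qed.

Lemma update_le1 (R : realType) (n : nat) (e : R) (y : 'I_n -> R) i c :
  0 <= e <= 1 -> (forall b, `|y b| <= 1) -> `|update e y i c| <= 1.
Proof.
move=> /andP[e0 e1] y1; rewrite /update; case: eqP => // _.
rewrite ler_norml; have y2 := onem_sqr_ge0 (y1 c).
have d0 : 0 <= e * (1 - y c ^+ 2) by rewrite mulr_ge0.
have d1 : e * (1 - y c ^+ 2) <= 1 - y c ^+ 2 by rewrite ler_piMl.
have := sqr_ge0 (1 - y c); have := sqr_ge0 (1 + y c).
by case: (i.2); rewrite ?expr1 ?expr0 => *; apply/andP; split; lra.
Qed.

(** Bayes: multiplying the product law by the likelihood of the observed sign
    gives a product law again, because the likelihood depends on one bit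
    only.  With [s] the sign at that position and [s ^+ 2 = 1], this is the
    identity [(1 + s * y) * (1 + c * (s - y)) = 1 + s * (y + c * (1 - y ^+ 2))],
    where [c] is [(-1) ^+ i.2 * (e / 2)]. *)
Lemma bits_prob_update (R : realType) (n : nat) (e : R) (y : 'I_n -> R)
    (i : 'I_n * bool) f :
  bits_prob y f * (1 + (-1) ^+ i.2 * (e / 2) * ((-1) ^+ f i.1 - y i.1)) =
  bits_prob (update e y i) f.
Proof.
rewrite /bits_prob (bigD1 i.1) //= [RHS](bigD1 i.1) //= /update eqxx.
under [X in _ = _ * X]eq_bigr => c /negPf -> do [].
by case: (f i.1); rewrite ?expr1 ?expr0; by field.
Qed.

(** The sum of the variances of the signs: what player 1 has left to exploit. *)
Definition uncertainty (R : realType) (n : nat) (y : 'I_n -> R) : R :=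
  \sum_b (1 - y b ^+ 2).

Lemma uncertainty_update (R : realType) (n : nat) (e : R) (y : 'I_n -> R) b :
  uncertainty (update e y (b, false)) + uncertainty (update e y (b, true)) =
  2 * (uncertainty y - e ^+ 2 / 4 * (1 - y b ^+ 2) ^+ 2).
Proof.
have E s : uncertainty (update e y (b, s)) =
    1 - (y b + (-1) ^+ s * (e / 2) * (1 - y b ^+ 2)) ^+ 2 +
    \sum_(c | c != b) (1 - y c ^+ 2).
  rewrite /uncertainty (bigD1 b) //= /update /= eqxx; congr (_ + _).
  by apply: eq_bigr => c /negPf ->.
rewrite !E {1}/uncertainty (bigD1 b (P := xpredT)) //= expr0 expr1.
by field.
Qed.

(** The second summand pads the number of states; the prior gives it no mass. *)
Definition bit_state (n r : nat) : finType := ({ffun 'I_n -> bool} + 'I_r)%type.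

Definition bit_sign (R : realType) (n r : nat) (x : bit_state n r) (b : 'I_n) : R :=
  if x is inl f then (-1) ^+ f b else 1.

Definition bit_payoff (R : realType) (n r : nat) (x : bit_state n r)
    (i : 'I_n * bool) (j : {ffun 'I_n -> bool}) : R :=
  (-1) ^+ i.2 * (bit_sign R x i.1 + (-1) ^+ j i.1).

Definition belief (R : realType) (n r : nat) (y : 'I_n -> R) :
    {ffun bit_state n r -> R} :=
  [ffun x : bit_state n r =>
     match x return R with inl f => bits_prob y f | inr _ => 0 end].
Arguments belief {R n} r y.

Lemma sum_belief (R : realType) (n r : nat) (y : 'I_n -> R)
    (F : bit_state n r -> R) :
  \sum_x belief r y x * F x = \sum_f bits_prob y f * F (inl f).
Proof.
rewrite big_sumType /= [X in _ + X]big1 ?addr0 => [|x _]; last first.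
  by rewrite ffunE mul0r.
by apply: eq_bigr => f _; rewrite ffunE.
Qed.

Lemma simplex_belief (R : realType) (n r : nat) (y : 'I_n -> R) :
  (forall b, `|y b| <= 1) -> simplex R (bit_state n r) (belief r y).
Proof.
move=> y1; split=> [x|].
  by rewrite ffunE; case: x => [f|_] //; exact: bits_prob_ge0.
under eq_bigr do rewrite -[belief _ _ _]mulr1.
by rewrite sum_belief; under eq_bigr do rewrite mulr1; exact: sum_bits_prob.
Qed.

Lemma bit_payoff_norm_le (R : realType) (n r : nat) :
  payoff_norm (@bit_payoff R n r) <= 2.
Proof.
do 3![apply: bigmax_le => // ? _].
rewrite /bit_payoff normrM normrX normrN1 expr1n mul1r.
apply: le_trans (ler_normD _ _) _; rewrite normrX normrN1 expr1n.
rewrite (_ : `|bit_sign R _ _| = 1) //.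
by rewrite /bit_sign; case: (X in if X is inl _ then _ else _) => *;
  rewrite ?normrX ?normrN1 ?expr1n ?normr1.
Qed.

Lemma bit_payoff_norm_gt0 (R : realType) (n r : nat) (b : 'I_n) :
  0 < payoff_norm (@bit_payoff R n r).
Proof.
pose z : {ffun 'I_n -> bool} := [ffun=> false].
suff : 2 <= payoff_norm (@bit_payoff R n r) by apply: lt_le_trans.
have -> : 2 = `|@bit_payoff R n r (inl z) (b, false) z|.
  by rewrite /bit_payoff /= !ffunE expr0 mul1r ger0_norm.
apply: le_trans (le_bigmax _ _ (inl z : bit_state n r)).
apply: le_trans (le_bigmax _ _ (b, false)).
exact: le_bigmax _ (fun j => `|bit_payoff R _ _ j|) z.
Qed.

Lemma bit_actions_gt0 (n : nat) (b : 'I_n) : (0 < #|{: 'I_n * bool}|)%N.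
Proof. by apply/card_gt0P; exists (b, true). Qed.

Lemma bit_replies_gt0 (n : nat) : (0 < #|{ffun 'I_n -> bool}|)%N.
Proof. by apply/card_gt0P; exists [ffun=> true]. Qed.

(** At the belief [q], player 2 answers with independent signs of mean opposite
    to those of the state: every pure action of player 1 then yields [0]. *)
Lemma bit_cav_le0 (R : realType) (n r : nat) (b : 'I_n) q :
  simplex R (bit_state n r) q -> cav (stage_value (@bit_payoff R n r)) q <= 0.
Proof.
move=> sq; apply: cav_stage_value_le => //.
- exact: bit_actions_gt0 b.
- exact: bit_replies_gt0.
move=> {sq}q sq; pose y b := \sum_x q x * bit_sign R x b.
have y1 c : `|- y c| <= 1.
  rewrite normrN -sq.2; apply: le_trans (ler_norm_sum _ _ _) _.
  apply: ler_sum => x _; rewrite normrM ger0_norm ?sq.1 //.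
  by case: x => *; rewrite ?normrX ?normrN1 ?expr1n ?normr1 mulr1.
exists [ffun j => bits_prob (fun c => - y c) j].
  split=> [j|]; first by rewrite ffunE; exact: bits_prob_ge0.
  by under eq_bigr do rewrite ffunE; exact: sum_bits_prob.
move=> a _; rewrite /mixed_payoff big1 // => i _.
have E j : \sum_x q x * bit_payoff R x i j =
    (-1) ^+ i.2 * (y i.1 + (-1) ^+ j i.1).
  have <- : \sum_x q x * (-1) ^+ j i.1 = (-1) ^+ j i.1.
    by rewrite -mulr_suml sq.2 mul1r.
  rewrite -big_split mulr_sumr /=.
  by apply: eq_bigr => x _; rewrite /bit_payoff mulrCA mulrDr.
under eq_bigr => j _ do rewrite ffunE E -mulrA.
rewrite -mulr_sumr.
under eq_bigr => j _ do rewrite mulrCA mulrDr.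
rewrite -mulr_sumr big_split /= -mulr_suml sum_bits_prob mean_bits_prob.
by rewrite mul1r subrr !mulr0.
Qed.

Definition posterior (R : realType) (n : nat) (e : R)
    (h : seq (('I_n * bool) * {ffun 'I_n -> bool})) : 'I_n -> R :=
  foldl (fun y a => update e y a.1) (fun=> 0) h.

Lemma posterior_le1 (R : realType) (n : nat) (e : R) h (b : 'I_n) :
  0 <= e <= 1 -> `|posterior e h b| <= 1.
Proof.
move=> e01; elim/last_ind: h b => [|h a IH] b.
  by rewrite /posterior /= normr0.
by rewrite /posterior foldl_rcons; exact: update_le1.
Qed.

(** The strategy of player 1: a uniform position, and there a sign correlated with
    that of the state.  Centring at the posterior mean makes the sign uniform
    from the point of view of player 2, who can thus not profit from
    predicting it. *)
Definition revealing (R : realType) (n r : nat) (e : R) (x : bit_state n r)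
    (h : seq (('I_n * bool) * {ffun 'I_n -> bool})) : {ffun 'I_n * bool -> R} :=
  [ffun i : 'I_n * bool => (2 * n%:R)^-1 *
    (1 + (-1) ^+ i.2 * (e / 2) * (bit_sign R x i.1 - posterior e h i.1))].

Lemma strategy1_revealing (R : realType) (n r : nat) (e : R) :
  (0 < n)%N -> 0 <= e <= 1 ->
  strategy1 R (bit_state n r) _ _ (@revealing R n r e).
Proof.
move=> n0 e01 x h; have /andP[e0 e1] := e01.
have nr : n%:R != 0 :> R by rewrite pnatr_eq0 -lt0n.
split=> [i|].
  rewrite ffunE; apply: mulr_ge0; first by rewrite invr_ge0 mulr_ge0.
  have := posterior_le1 h i.1 e01; rewrite ler_norml => /andP[ym yM].
  have : bit_sign R x i.1 = 1 \/ bit_sign R x i.1 = -1.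
    by case: (x) => [f|_] /=; [case: (f _)|]; rewrite ?expr1 ?expr0; [right|left|left].
  by move=> [] ->; case: (i.2); rewrite ?expr1 ?expr0; nra.
rewrite sum_prod.
rewrite (eq_bigr (fun=> n%:R^-1)) => [|b _].
  by rewrite sumr_const card_ord -[LHS]mulr_natl mulfV.
rewrite big_bool !ffunE /= expr0 expr1; field.
by rewrite nr.
Qed.

(** Backward induction.  The uncertainty is the currency: a stage with
    uncertainty [S] pays [e / (2 * n) * S] and costs on average at most
    [e ^+ 2 / 4] of it, whence [m * S] minus a quadratic term in [m]. *)
Lemma bit_continuation_ge (R : realType) (n r m : nat) (e : R) tau h :
  (0 < n)%N -> 0 <= e <= 1 -> strategy2 R _ _ tau ->
  e / (2 * n%:R) *
    (m%:R * uncertainty (posterior e h) - e ^+ 2 / 4 * m%:R ^+ 2) <=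
  continuation_payoff (@bit_payoff R n r) (@revealing R n r e) tau m
    (belief r (posterior e h)) h.
Proof.
move=> n0 e01 s2; have s1 := @strategy1_revealing R n r e n0 e01.
have /andP[e0 e1] := e01.
have nr : 0 < n%:R :> R by rewrite ltr0n.
elim: m h => [|m IH] h.
  by rewrite continuation_payoff0 expr0n !mul0r mulr0 subrr mulr0.
set y := posterior e h; set S := uncertainty y.
rewrite continuation_payoffS //.
(* The uniform likelihood [(2 * n)^-1] of each action of player 1 factors out. *)
have Ew i : (fun x => belief r y x * revealing e x h i) =
    (fun x => (2 * n%:R)^-1 * belief r (update e y i) x).
  apply/funext => x; rewrite !ffunE mulrCA; congr (_ * _).
  by case: x => [f|x] /=; [exact: bits_prob_update|rewrite mul0r].
pose B i : R := e / (2 * n%:R) *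
  (m%:R * uncertainty (update e y i) - e ^+ 2 / 4 * m%:R ^+ 2).
(* [B i] bounds the payoff of the [m] stages that follow the action [i]. *)
have step (i : 'I_n * bool) (j : {ffun 'I_n -> bool}) : (2 * n%:R)^-1 *
    ((-1) ^+ i.2 * (update e y i i.1 + (-1) ^+ j i.1) + B i) <=
    \sum_x belief r y x * revealing e x h i * bit_payoff R x i j +
    continuation_payoff (@bit_payoff R n r) (@revealing R n r e) tau m
      (fun x => belief r y x * revealing e x h i) (rcons h (i, j)).
  under eq_bigr => x _ do rewrite (congr1 (fun g => g x) (Ew i)) -mulrA.
  rewrite Ew continuation_payoffZ -mulr_sumr -mulrDr.
  rewrite ler_wpM2l ?invr_ge0 ?mulr_ge0 //; apply: lerD.
    rewrite sum_belief /bit_payoff /=.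
    under eq_bigr => f _ do rewrite mulrCA mulrDr.
    rewrite -mulr_sumr big_split /= mean_bits_prob -mulr_suml sum_bits_prob.
    by rewrite mul1r.
  have := IH (rcons h (i, j)).
  by rewrite /posterior foldl_rcons -/(posterior e h).
have total : \sum_(i : 'I_n * bool) \sum_(j : {ffun 'I_n -> bool})
    tau h j * ((2 * n%:R)^-1 *
    ((-1) ^+ i.2 * (update e y i i.1 + (-1) ^+ j i.1) + B i)) <=
    \sum_i \sum_j tau h j *
    (\sum_x belief r y x * revealing e x h i * bit_payoff R x i j +
     continuation_payoff (@bit_payoff R n r) (@revealing R n r e) tau m
       (fun x => belief r y x * revealing e x h i) (rcons h (i, j))).
  apply: ler_sum => i _; apply: ler_sum => j _.
  by apply: ler_wpM2l; [exact: (s2 h).1|exact: step].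
apply: le_trans total; rewrite exchange_big /=.
set L := (X in X <= _).
have -> : L = \sum_j tau h j * L by rewrite -mulr_suml (s2 h).2 mul1r.
apply: ler_sum => j _.
rewrite -mulr_sumr; apply: ler_wpM2l; first exact: (s2 h).1.
rewrite sum_prod /=.
(* Averaging over the sign cancels the contribution of [j], whatever [tau]. *)
have gain (b : 'I_n) : n%:R^-1 * (e / 2 * (1 - y b ^+ 2) +
      e / (2 * n%:R) * (m%:R * (S - e ^+ 2 / 4) - e ^+ 2 / 4 * m%:R ^+ 2)) <=
    \sum_(s : bool) (2 * n%:R)^-1 *
      ((-1) ^+ s * (update e y (b, s) b + (-1) ^+ j b) + B (b, s)).
  have -> : \sum_(s : bool) (2 * n%:R)^-1 *
      ((-1) ^+ s * (update e y (b, s) b + (-1) ^+ j b) + B (b, s)) =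
      n%:R^-1 * (e / 2 * (1 - y b ^+ 2) + e / (2 * n%:R) *
       (m%:R * ((uncertainty (update e y (b, false)) +
                 uncertainty (update e y (b, true))) / 2)
         - e ^+ 2 / 4 * m%:R ^+ 2)).
    rewrite big_bool /B /update /= !eqxx expr0 expr1; field.
    by rewrite gt_eqF.
  rewrite uncertainty_update -/S.
  apply: ler_wpM2l; first by rewrite invr_ge0 ltW.
  rewrite lerD2l; apply: ler_wpM2l; first by rewrite divr_ge0 // mulr_ge0 // ltW.
  rewrite lerD2r; apply: ler_wpM2l => //.
  rewrite [2 * _]mulrC mulfK ?pnatr_eq0 // lerD2l lerN2.
  apply: ler_piMr; first by rewrite divr_ge0 ?sqr_ge0.
  apply: exprn_ile1; first exact: onem_sqr_ge0 (posterior_le1 h b e01).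
  by rewrite lerBlDr lerDl sqr_ge0.
apply: le_trans (ler_sum _ (fun b _ => gain b)).
rewrite -mulr_sumr big_split /= -mulr_sumr -/(uncertainty y) -/S.
rewrite sumr_const card_ord -[X in _ + X]mulr_natl /L.
rewrite -subr_ge0 (_ : _ - _ = e / (2 * n%:R) * (e ^+ 2 / 4) * (m%:R + 1)).
  by rewrite mulr_ge0 ?addr_ge0 // mulr_ge0 ?divr_ge0 ?sqr_ge0 // mulr_ge0 // ltW.
rewrite -[m.+1]addn1 natrD; field.
by rewrite gt_eqF.
Qed.

Lemma bit_value_ge (R : realType) (n r k : nat) (e : R) :
  (0 < n)%N -> (0 < k)%N -> 0 <= e <= 1 ->
  e / 2 * (1 - e ^+ 2 / 4 * k%:R / n%:R) <=
  repeated_value (@bit_payoff R n r) k (belief r (fun=> 0)).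
Proof.
move=> n0 k0 e01; have b : 'I_n := Ordinal n0.
apply: (repeated_value_ge (bit_actions_gt0 b) (bit_replies_gt0 n) _
  (@strategy1_revealing R n r e n0 e01)).
  by apply: simplex_belief => c; rewrite normr0.
move=> tau s2; rewrite expected_payoffE.
have kr : 0 < k%:R :> R by rewrite ltr0n.
have nr : 0 < n%:R :> R by rewrite ltr0n.
rewrite ler_pdivlMl //.
apply: le_trans (bit_continuation_ge r k [::] n0 e01 s2).
rewrite /uncertainty /posterior /=.
under eq_bigr do rewrite expr0n subr0.
rewrite sumr_const card_ord le_eqVlt; apply/orP; left; apply/eqP; field.
by rewrite gt_eqF.
Qed.

(** * Comparison of the two orders of magnitude *)

(** With one state, the bound on the variation is linear in its free
    parameter. *)
Lemma max_variation1_le0 (R : realType) (k : nat) :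
  (0 < k)%N -> (max_variation R k 1 <= 0)%E.
Proof.
move=> k0; apply/lee_addgt0Pr => e e0; rewrite add0e.
have kr : 0 < k%:R :> R by rewrite ltr0n.
have l0 : 0 < e / (2 * k%:R) by rewrite divr_gt0 ?mulr_gt0.
apply: le_trans (max_variation_le k 1 l0) _.
rewrite lee_fin ln1 mul0r addr0 le_eqVlt; apply/orP; left; apply/eqP; field.
by rewrite gt_eqF.
Qed.

Lemma scaled_variation_le (R : realType) (V : \bar R) (b c g k : R) :
  0 < k -> 0 <= c -> (V <= b%:E)%E -> c * (b / k) <= g ->
  (c%:E * (V / k%:E) <= g%:E)%E.
Proof.
move=> k0 c0 Vb bg; apply: (@le_trans _ _ (c * (b / k))%:E); last by rewrite lee_fin.
rewrite EFinM; apply: lee_wpmul2l; first by rewrite lee_fin.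
rewrite inver gt_eqF // EFinM; apply: lee_wpmul2r => //.
by rewrite lee_fin invr_ge0 ltW.
Qed.

Lemma ln_le_of_lt_pow2 (R : realType) (n d : nat) :
  (0 < d)%N -> (d < 2 ^ n)%N -> ln d%:R <= n%:R :> R.
Proof.
move=> d0 dn.
apply: (@le_trans _ _ (ln (2 ^+ n))).
  by rewrite ler_ln ?posrE ?ltr0n ?exprn_gt0 // -natrX ler_nat ltnW.
rewrite lnXn // -[leLHS]mulr_natl ler_piMr //.
by have := @le_ln1Dx R 1; apply; lra.
Qed.

Theorem theorem3 (R : realType) :
  exists C : R, 0 < C /\
    forall k d : nat, (0 < k)%N -> (0 < d)%N -> (d <= 2 ^ k)%N ->
      exists Gamma : game R,
        [/\ #|states Gamma| = d,
            0 < payoff_norm (payoff Gamma) &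
            ((C * payoff_norm (payoff Gamma))%:E
               * (max_variation R k d / k%:R%:E)
             <= (repeated_value (payoff Gamma) k (prior Gamma)
                 - cav (stage_value (payoff Gamma)) (prior Gamma))%:E)%E].
Proof.
exists 32^-1; split; first by rewrite invr_gt0.
move=> k d k0 d0 dk; have kr : 0 < k%:R :> R by rewrite ltr0n.
have [d1|d1] := leqP d 1.
  have {d0 d1 dk}-> : d = 1%N by apply/eqP; rewrite eqn_leq d1.
  pose G (_ _ _ : unit) : R := 1.
  pose a : {ffun unit -> R} := [ffun=> 1].
  have sa : simplex R unit a.
    split=> [x|]; first by rewrite ffunE.
    by rewrite (big_pred1 tt) ?ffunE // => -[].
  have u0 : (0 < #|{: unit}|)%N by rewrite card_unit.
  have N : 0 < payoff_norm G.
    apply: lt_le_trans (le_bigmax _ _ tt).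
    apply: lt_le_trans (le_bigmax _ _ tt).
    apply: lt_le_trans (le_bigmax _ _ tt).
    by rewrite normr1.
  exists (@Game R unit a unit unit G sa u0 u0); split=> //=.
    by rewrite card_unit.
  apply: (@scaled_variation_le _ _ 0) => //.
  - by rewrite mulr_ge0 ?invr_ge0 // ltW.
  - exact: max_variation1_le0.
  rewrite mul0r mulr0 subr_ge0; apply: (@le_trans _ _ 1).
    apply: cav_stage_value_le => // q sq; exists a => // b sb.
    by rewrite mixed_payoff_cst.
  apply: (@repeated_value_ge _ _ _ _ _ _ _ (fun _ _ => a)) => // tau s2.
  by rewrite expected_payoff_cst.
(* One fair bit for each factor [2] in [d], and [e ^+ 2 * k = n]. *)
pose n := trunc_log 2 d.
have n0 : (0 < n)%N by rewrite trunc_log_gt0.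
have nd : (2 ^ n <= d)%N by apply: trunc_logP.
have dn : (d < 2 ^ n.+1)%N by apply: trunc_log_ltn.
have nk : (n <= k)%N by rewrite -(@leq_exp2l 2) // (leq_trans nd).
have nr : 0 < n%:R :> R by rewrite ltr0n.
pose e : R := Num.sqrt (n%:R / k%:R).
have e0 : 0 < e by rewrite sqrtr_gt0 divr_gt0.
have e2 : e ^+ 2 = n%:R / k%:R by rewrite sqr_sqrtr // divr_ge0.
have e1 : e <= 1.
  rewrite -(@ler_pXn2r _ 2) ?nnegrE ?(ltW e0) // e2 expr1n.
  by rewrite ler_pdivrMr // mul1r ler_nat.
pose r := (d - 2 ^ n)%N.
have b : 'I_n := Ordinal n0.
have sp : simplex R (bit_state n r) (belief r (fun=> 0)).
  by apply: simplex_belief => c; rewrite normr0.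
exists (Game (@bit_payoff R n r) sp (bit_actions_gt0 b) (bit_replies_gt0 n)).
have N := bit_payoff_norm_gt0 R r b.
split=> //=.
  by rewrite card_sum card_ffun card_bool !card_ord subnKC.
(* The same [e] serves as the free parameter in the bound on the variation. *)
apply: (scaled_variation_le kr _ (max_variation_le k d e0)).
  by rewrite mulr_ge0 ?invr_ge0 // ltW.
apply: (@le_trans _ _ (3 / 8 * e)).
  have lnd : ln d%:R <= 2 * n%:R :> R.
    apply: le_trans (ln_le_of_lt_pow2 R d0 dn) _.
    by rewrite -natrM ler_nat; lia.
  have ke : n%:R = k%:R * e ^+ 2 by rewrite e2 mulrC divfK ?gt_eqF.
  have V : 2 * (k%:R * e + ln d%:R / e) / k%:R <= 6 * e.
    rewrite ler_pdivrMr //.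
    have : ln d%:R / e <= 2 * (k%:R * e).
      by rewrite ler_pdivrMr //; move: lnd; rewrite ke; lra.
    by lra.
  apply: le_trans (_ : 32^-1 * 2 * (6 * e) <= _); last by lra.
  apply: ler_pM => //.
  - by rewrite mulr_ge0 ?invr_ge0 // ltW.
  - rewrite divr_ge0 ?(ltW kr) // mulr_ge0 // addr_ge0 //.
      by rewrite mulr_ge0 // ltW.
    by rewrite divr_ge0 ?(ltW e0) // ln_ge0 // ler1n.
  - by rewrite ler_pM2l ?invr_gt0 //; exact: bit_payoff_norm_le.
have e01 : 0 <= e <= 1 by rewrite ltW.
have := bit_value_ge r n0 k0 e01; have := bit_cav_le0 b sp.
rewrite (_ : e ^+ 2 / 4 * k%:R / n%:R = 4^-1); first by lra.
by rewrite e2; field; rewrite !gt_eqF.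
Qed.
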